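(* For $\mu\neq-1/2$ and for $x\in\mathbb{R}$, the following parameter derivative formula holds true: $$\left.\frac{\partial \mathrm{M}_{\kappa,\mu}(x)}{\partial\kappa}\right|_{\kappa=-\mu-1/2}=-\frac{x^{\mu+3/2}}{2\mu+1}\,e^{x/2}\;{}_2F_2\!\left(\left.\begin{array}{c}1,1\\ 2(\mu+1),\,2\end{array}\right|-x\right).$$
   Context: The Whittaker function is $\mathrm{M}_{\kappa,\mu}(x)=x^{\mu+1/2}e^{-x/2}\,{}_1F_1\!\left(\tfrac12+\mu-\kappa;\,1+2\mu;\,x\right)$, defined for $2\mu\neq-1,-2,\ldots$, where ${}_pF_q$ denotes the generalized hypergeometric function. *)

(* Defs.v *)
From Stdlib Require Import Reals Factorial List.
From Coquelicot Require Import Coquelicot.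
Import ListNotations.
Open Scope C_scope.

(* Coquelicot's [Series] is real-valued only; [C_Series] is the total sum
   operator for complex series, see [is_series_C_Series]. *)
Definition C_Series (a : nat -> C) : C :=
  (Series (fun n => Re (a n)), Series (fun n => Im (a n))).

Lemma is_series_C_Series (a : nat -> C) (l : C) :
  is_series (V := C_NormedModule) a l -> C_Series a = l.
Proof.
intros H.
assert (Hre : forall n, fst (sum_n (G := C_AbelianMonoid) a n) = sum_n (fun k => Re (a k)) n).
{ intros n; induction n as [|n IH].
  - now rewrite !sum_O.
  - now rewrite !sum_Sn, <- IH. }
assert (Him : forall n, snd (sum_n (G := C_AbelianMonoid) a n) = sum_n (fun k => Im (a k)) n).
{ intros n; induction n as [|n IH].
  - now rewrite !sum_O.
  - now rewrite !sum_Sn, <- IH. }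
unfold C_Series; destruct l as [l1 l2]; f_equal; apply is_series_unique;
  unfold is_series; apply filterlim_locally; intros eps;
  generalize (proj1 (filterlim_locally _ _) H eps);
  apply filter_imp; intros n [H1 H2].
- now rewrite <- Hre.
- now rewrite <- Him.
Qed.

Fixpoint Cpoch (a : C) (n : nat) : C :=
  match n with
  | O => 1
  | S m => Cpoch a m * (a + INR m)
  end.

Definition Cprod (s : list C) : C := fold_right Cmult (RtoC 1) s.

(* Meaningful when no lower parameter is a nonpositive integer and the series
   converges (always so if length a <= length b). *)
Definition pFq (a b : list C) (z : C) : C :=
  C_Series (fun n =>
    Cprod (map (fun c => Cpoch c n) a) / Cprod (map (fun c => Cpoch c n) b)
    * (z ^ n / INR (fact n))).

Definition Cexp (z : C) : C :=
  exp (Re z) * (cos (Im z), sin (Im z)).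

(* Principal logarithm of a nonzero real, with values in R + i (-PI, PI]. *)
Definition Rlog (x : R) : C :=
  (ln (Rabs x), if Rlt_dec x 0 then PI else 0%R).

(* Principal value of x^a for real, possibly negative, x; 0^0 = 1, and 0^a = 0
   for a <> 0 (conventional when Re a <= 0, where 0^a has no meaning). *)
Definition Rcpow (x : R) (a : C) : C :=
  if Req_EM_T x 0 then (if Ceq_dec a 0 then 1 else 0)
  else Cexp (a * Rlog x).

Definition whittakerM (kappa mu : C) (x : R) : C :=
  Rcpow x (mu + 1 / 2) * exp (- x / 2)
  * pFq [1 / 2 + mu - kappa] [1 + 2 * mu] x.

(* Main.v *)
(* Put b = 2 mu + 1. The parameter derivative of (a)_n / (b)_n at a = b is
   H_n = sum_(k < n) 1/(b+k), with a quadratic error that is at most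
   (1+M)^n |a-b|^2 when |1/(b+k)| <= M and |a-b| <= 1, so the series may be
   differentiated termwise. The resulting series sum H_n x^n/n! is the Cauchy
   product of e^x with sum_(m >= 1) (-1)^(m-1) x^m / (m (b)_m), and the latter
   is (x/b) 2F2(1,1; b+1,2; -x). *)

Require Import Defs.
From Stdlib Require Import Reals Factorial List Lra Lia.
From Coquelicot Require Import Coquelicot.
Import ListNotations.
Open Scope C_scope.

(** * Absolute convergence and termwise algebra of complex series *)

Lemma im_le_Cmod (c : C) : (Rabs (Im c) <= Cmod c)%R.
Proof. eapply Rle_trans; [apply Rmax_r | apply Rmax_Cmod]. Qed.

Lemma Cmod_le_re_im (c : C) : (Cmod c <= Rabs (Re c) + Rabs (Im c))%R.
Proof.
replace c with (RtoC (Re c) + RtoC (Im c) * Ci) at 1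
  by (destruct c as [u v]; unfold RtoC, Ci, Cplus, Cmult; simpl; f_equal; ring).
eapply Rle_trans; [apply Cmod_triangle|].
rewrite Cmod_mult, !Cmod_R.
replace (Cmod Ci) with 1%R; [lra|].
unfold Cmod, Ci; simpl.
replace (0 * (0 * 1) + 1 * (1 * 1))%R with 1%R by ring; now rewrite sqrt_1.
Qed.

Lemma ex_series_le_R (a b : nat -> R) :
  (forall n, (Rabs (a n) <= b n)%R) -> ex_series b -> ex_series a.
Proof. intros H; apply (ex_series_le (K := R_AbsRing) (V := R_CompleteNormedModule)), H. Qed.

Lemma ex_series_Re (a : nat -> C) :
  ex_series (fun n => Cmod (a n)) -> ex_series (fun n => Rabs (Re (a n))).
Proof.
apply ex_series_le_R; intros n; rewrite Rabs_Rabsolu; apply re_le_Cmod.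
Qed.

Lemma ex_series_Im (a : nat -> C) :
  ex_series (fun n => Cmod (a n)) -> ex_series (fun n => Rabs (Im (a n))).
Proof.
apply ex_series_le_R; intros n; rewrite Rabs_Rabsolu; apply im_le_Cmod.
Qed.

Lemma ex_series_Cmod_scal (c : C) (a : nat -> C) :
  ex_series (fun n => Cmod (a n)) -> ex_series (fun n => Cmod (c * a n)).
Proof.
intros H; apply ex_series_le_R with (fun n => (Cmod c * Cmod (a n))%R).
- intros n; rewrite Cmod_mult, Rabs_pos_eq; [lra|].
  apply Rmult_le_pos; apply Cmod_ge_0.
- apply (ex_series_scal_l (K := R_AbsRing) (V := R_NormedModule)), H.
Qed.

Lemma ex_series_Cmod_plus (a b : nat -> C) :
  ex_series (fun n => Cmod (a n)) -> ex_series (fun n => Cmod (b n)) ->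
  ex_series (fun n => Cmod (a n + b n)).
Proof.
intros Ha Hb; apply ex_series_le_R with (fun n => (Cmod (a n) + Cmod (b n))%R).
- intros n; rewrite Rabs_pos_eq by apply Cmod_ge_0; apply Cmod_triangle.
- now apply (ex_series_plus (K := R_AbsRing) (V := R_NormedModule)).
Qed.

Lemma C_Series_ext (a b : nat -> C) :
  (forall n, a n = b n) -> C_Series a = C_Series b.
Proof.
intros H; unfold C_Series; f_equal; apply Series_ext; intros n; now rewrite H.
Qed.

Lemma C_Series_plus (a b : nat -> C) :
  ex_series (fun n => Cmod (a n)) -> ex_series (fun n => Cmod (b n)) ->
  C_Series (fun n => a n + b n) = C_Series a + C_Series b.
Proof.
intros Ha Hb; unfold C_Series, Cplus at 3; simpl; f_equal;
  rewrite <- Series_plus; try reflexivity; apply ex_series_Rabs;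
  now (apply ex_series_Re || apply ex_series_Im).
Qed.

Lemma C_Series_scal (c : C) (a : nat -> C) :
  ex_series (fun n => Cmod (a n)) ->
  C_Series (fun n => c * a n) = c * C_Series a.
Proof.
intros Ha.
assert (Hre := ex_series_Rabs _ (ex_series_Re a Ha)).
assert (Him := ex_series_Rabs _ (ex_series_Im a Ha)).
assert (Hs : forall (k : R) u, ex_series u -> ex_series (fun n => (k * u n)%R)).
{ intros k u; apply (ex_series_scal_l (K := R_AbsRing) (V := R_NormedModule)). }
unfold C_Series, Cmult at 3; simpl; f_equal.
- rewrite <- !Series_scal_l, <- Series_minus by now apply Hs.
  apply Series_ext; intros n; apply re_mult.
- rewrite <- !Series_scal_l, <- Series_plus by now apply Hs.
  apply Series_ext; intros n; etransitivity; [apply im_mult|]; unfold Re, Im; ring.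
Qed.

Lemma C_Series_incr_1 (a : nat -> C) :
  ex_series (fun n => Cmod (a n)) ->
  C_Series a = a 0%nat + C_Series (fun n => a (S n)).
Proof.
intros Ha.
unfold C_Series, Cplus; simpl; f_equal; rewrite Series_incr_1; try reflexivity;
  apply ex_series_Rabs; now (apply ex_series_Re || apply ex_series_Im).
Qed.

(** The real and imaginary parts are each bounded by [Series r]. The resulting factor 2 is harmless,
    since only some constant in front of the quadratic error is wanted. *)
Lemma Cmod_C_Series_le (a : nat -> C) (r : nat -> R) :
  (forall n, (Cmod (a n) <= r n)%R) -> ex_series r ->
  (Cmod (C_Series a) <= 2 * Series r)%R.
Proof.
intros H Hr; eapply Rle_trans; [apply Cmod_le_re_im|].
assert (Hb : forall u : nat -> R,
  (forall n, (Rabs (u n) <= r n)%R) -> (Rabs (Series u) <= Series r)%R).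
{ intros u Hu; eapply Rle_trans; [apply Series_Rabs|].
  - apply ex_series_le_R with r; [|exact Hr].
    intros n; now rewrite Rabs_Rabsolu.
  - apply Series_le; [|exact Hr]; intros n; split; [apply Rabs_pos | apply Hu]. }
assert (H1 := Hb (fun n => Re (a n))
  (fun n => Rle_trans _ _ _ (re_le_Cmod (a n)) (H n))).
assert (H2 := Hb (fun n => Im (a n))
  (fun n => Rle_trans _ _ _ (im_le_Cmod (a n)) (H n))).
unfold C_Series; cbn [Re Im fst snd]; lra.
Qed.

(** * Finite complex sums and the Cauchy product *)

(** The upper bound is excluded, so inductions start from the empty sum; [Csum a (S n)] is the
    counterpart of [sum_f_R0 a n]. *)
Fixpoint Csum (a : nat -> C) (n : nat) : C :=
  match n with
  | O => 0
  | S m => Csum a m + a m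
  end.

Lemma Csum_ext (a b : nat -> C) (n : nat) :
  (forall k, (k < n)%nat -> a k = b k) -> Csum a n = Csum b n.
Proof.
induction n as [|n IH]; intros H; simpl; [reflexivity|].
rewrite IH by (intros; apply H; lia); rewrite H by lia; reflexivity.
Qed.

Lemma Csum_plus (a b : nat -> C) (n : nat) :
  Csum (fun k => a k + b k) n = Csum a n + Csum b n.
Proof. induction n as [|n IH]; simpl; [ring | rewrite IH; ring]. Qed.

Lemma Csum_scal (c : C) (a : nat -> C) (n : nat) :
  Csum (fun k => c * a k) n = c * Csum a n.
Proof. induction n as [|n IH]; simpl; [ring | rewrite IH; ring]. Qed.

Lemma Csum_incr_1 (a : nat -> C) (n : nat) :
  Csum a (S n) = a 0%nat + Csum (fun k => a (S k)) n.
Proof.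
induction n as [|n IH]; [simpl; ring|].
change (Csum a (S (S n))) with (Csum a (S n) + a (S n)).
rewrite IH; simpl; ring.
Qed.

Lemma Re_Csum (a : nat -> C) (n : nat) :
  Re (Csum a (S n)) = sum_f_R0 (fun k => Re (a k)) n.
Proof.
induction n as [|n IH]; [cbn [Csum sum_f_R0]; now rewrite Cplus_0_l|].
change (Csum a (S (S n))) with (Csum a (S n) + a (S n)).
now rewrite re_plus, IH.
Qed.

Lemma Im_Csum (a : nat -> C) (n : nat) :
  Im (Csum a (S n)) = sum_f_R0 (fun k => Im (a k)) n.
Proof.
induction n as [|n IH]; [cbn [Csum sum_f_R0]; now rewrite Cplus_0_l|].
change (Csum a (S (S n))) with (Csum a (S n) + a (S n)).
now rewrite im_plus, IH.
Qed.

(** Because [p] is real, taking real and imaginary parts commutes with multiplication by [p k],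
    which leaves two Cauchy products of absolutely convergent real series. *)
Lemma C_Series_Cauchy_product (p : nat -> R) (a : nat -> C) :
  ex_series (fun n => Rabs (p n)) -> ex_series (fun n => Cmod (a n)) ->
  C_Series (fun n => Csum (fun k => p k * a (n - k)%nat) (S n))
  = Series p * C_Series a.
Proof.
intros Hp Ha.
assert (Hre := ex_series_Re a Ha).
assert (Him := ex_series_Im a Ha).
assert (Hm : forall u, ex_series (fun n => Rabs (u n)) ->
  Series (fun n => sum_f_R0 (fun k => (p k * u (n - k)%nat)%R) n)
  = (Series p * Series u)%R).
{ intros u Hu; apply is_series_unique, is_series_mult; trivial;
    now apply Series_correct, ex_series_Rabs. }
apply injective_projections.
- change (fst (Series p * C_Series a)) with (Re (Series p * C_Series a)).
  rewrite re_scal_l; unfold C_Series; cbn [Re fst].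
  rewrite <- Hm by exact Hre; apply Series_ext; intros n.
  rewrite Re_Csum; apply sum_eq; intros k _; apply re_scal_l.
- change (snd (Series p * C_Series a)) with (Im (Series p * C_Series a)).
  rewrite im_scal_l; unfold C_Series; cbn [Im snd].
  rewrite <- Hm by exact Him; apply Series_ext; intros n.
  rewrite Im_Csum; apply sum_eq; intros k _; apply im_scal_l.
Qed.

(** * Complex derivatives from quadratic errors, and majorants by the exponential series *)

Lemma is_derive_quadratic (f : C -> C) (z l : C) (K : R) :
  (forall y, (Cmod (y - z) <= 1)%R ->
     (Cmod (f y - f z - (y - z) * l) <= K * Cmod (y - z) ^ 2)%R) ->
  is_derive (K := C_AbsRing) (V := C_NormedModule) f z l.
Proof.
intros H; split; [apply is_linear_scal_l|].
intros z' Hz'.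
(* Differentiability quantifies over all limits of the neighbourhood filter of [z]; the only one is
   [z] itself. *)
rewrite <- (is_filter_lim_locally_unique (V := AbsRing_NormedModule C_AbsRing) z z' Hz').
clear z' Hz'; intros eps.
assert (HK : (0 < Rabs K + 1)%R) by (generalize (Rabs_pos K); lra).
(* Radius 1 keeps [y] where the hypothesis applies, and the other radius makes K |y - z| at most
   eps. Using |K| + 1 covers any sign of [K] and avoids division by zero. *)
assert (Hd : (0 < Rmin 1 (eps / (Rabs K + 1)))%R).
{ apply Rmin_glb_lt; [lra|]; apply Rdiv_lt_0_compat; [apply cond_pos | lra]. }
exists (mkposreal _ Hd); intros y Hy.
change (Cmod (f y - f z - (y - z) * l) <= eps * Cmod (y - z))%R.
change (Cmod (y - z) < Rmin 1 (eps / (Rabs K + 1)))%R in Hy.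
assert (H1 := Rlt_le_trans _ _ _ Hy (Rmin_l _ _)).
assert (H2 := Rlt_le_trans _ _ _ Hy (Rmin_r _ _)).
assert (H0 := Cmod_ge_0 (y - z)).
eapply Rle_trans; [apply H; lra|].
replace (K * Cmod (y - z) ^ 2)%R with (K * Cmod (y - z) * Cmod (y - z))%R by ring.
apply Rmult_le_compat_r; [exact H0|].
apply Rle_trans with ((Rabs K + 1) * Cmod (y - z))%R.
- apply Rmult_le_compat_r; [exact H0|]; generalize (Rle_abs K); lra.
- apply Rmult_le_reg_r with (/ (Rabs K + 1))%R; [now apply Rinv_0_lt_compat|].
  replace ((Rabs K + 1) * Cmod (y - z) * / (Rabs K + 1))%R with (Cmod (y - z))
    by (field; lra).
  unfold Rdiv in H2; lra.
Qed.

Lemma is_series_exp (x : R) : is_series (fun n => (x ^ n / INR (fact n))%R) (exp x).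
Proof.
apply is_series_ext with (fun n => (/ INR (fact n) * x ^ n)%R).
- intros n; apply Rmult_comm.
- apply is_pseries_R, is_exp_Reals.
Qed.

Lemma INR_S_neq_0 (n : nat) : RtoC (INR (S n)) <> 0.
Proof. intros E; apply RtoC_inj in E; revert E; apply not_0_INR; lia. Qed.

Lemma fact_neq_0_C (n : nat) : RtoC (INR (fact n)) <> 0.
Proof. intros E; apply RtoC_inj in E; revert E; apply INR_fact_neq_0. Qed.

Lemma RtoC_INR_S (n : nat) : RtoC (INR (S n)) = RtoC (INR n) + 1.
Proof. now rewrite S_INR, RtoC_plus. Qed.

Lemma RtoC_fact_S (n : nat) :
  RtoC (INR (fact (S n))) = (RtoC (INR n) + 1) * RtoC (INR (fact n)).
Proof. rewrite fact_simpl, mult_INR, RtoC_mult, RtoC_INR_S; reflexivity. Qed.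

Lemma Cpow_div_fact (x : R) (n : nat) :
  RtoC x ^ n / RtoC (INR (fact n)) = RtoC (x ^ n / INR (fact n)).
Proof. now rewrite RtoC_div, RtoC_pow by apply INR_fact_neq_0. Qed.

Lemma Cmod_exp_term (x : R) (n : nat) :
  Cmod (RtoC x ^ n / RtoC (INR (fact n))) = (Rabs x ^ n / INR (fact n))%R.
Proof.
rewrite Cpow_div_fact, Cmod_R, Rabs_div, RPow_abs by apply INR_fact_neq_0.
now rewrite (Rabs_pos_eq (INR _)) by apply pos_INR.
Qed.

(** The factorial beats geometric growth: the terms are dominated by A (q|x|)^n / n!. The complex
    series below get their absolute convergence from this test. *)
Lemma ex_series_Cmod_exp_geom (a : nat -> C) (x A q : R) :
  (forall n, (Cmod (a n) <= A * q ^ n)%R) ->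
  ex_series (fun n => Cmod (a n * (RtoC x ^ n / RtoC (INR (fact n))))).
Proof.
intros H.
apply ex_series_le_R with (fun n => (A * ((q * Rabs x) ^ n / INR (fact n)))%R).
- intros n; rewrite Rabs_pos_eq by apply Cmod_ge_0.
  rewrite Cmod_mult, Cmod_exp_term, Rpow_mult_distr.
  replace (A * (q ^ n * Rabs x ^ n / INR (fact n)))%R
    with (A * q ^ n * (Rabs x ^ n / INR (fact n)))%R
    by (unfold Rdiv; ring).
  apply Rmult_le_compat_r; [|apply H].
  apply Rdiv_le_0_compat; [apply pow_le, Rabs_pos | apply INR_fact_lt_0].
- apply (ex_series_scal_l (K := R_AbsRing) (V := R_NormedModule)).
  eexists; apply is_series_exp.
Qed.

(** * First-order expansion of 1F1(a; b; x) around a = b *)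

Section LowerParameter.

Variable b : C.
Hypothesis b_regular : forall n : nat, b + INR n <> 0.

Lemma Cpoch_neq_0 (n : nat) : Cpoch b n <> 0.
Proof.
induction n as [|n IH]; simpl.
- intros E; apply RtoC_inj in E; lra.
- now apply Cmult_neq_0.
Qed.

(** The quotient (k+1)/|b+k| tends to 1. The weight k+1 is kept because products of these quotients
    control n!/(b)_n; dropping it bounds the reciprocals alone. *)
Lemma reciprocal_shift_bound :
  exists M : R, forall k : nat, (INR (S k) * Cmod (/ (b + INR k)) <= M)%R.
Proof.
assert (Hfin : forall N, exists M, forall k, (k < N)%nat ->
  (INR (S k) * Cmod (/ (b + INR k)) <= M)%R).
{ induction N as [|N [M HM]]; [exists 0%R; intros; lia|].
  exists (Rmax M (INR (S N) * Cmod (/ (b + INR N)))); intros k Hk.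
  destruct (Nat.eq_dec k N) as [->|Hne]; [apply Rmax_r|].
  eapply Rle_trans; [apply HM; lia | apply Rmax_l]. }
(* For k >= 2|b| + 1 the triangle inequality gives k + 1 <= 2(k - |b|) <= 2|b+k|, hence the bound 2
   on the tail; finitely many indices remain. *)
destruct (nfloor_ex (2 * Cmod b + 1)) as [N [_ HN]].
{ generalize (Cmod_ge_0 b); lra. }
destruct (Hfin (S N)) as [M HM].
exists (Rmax M 2); intros k.
destruct (Nat.lt_ge_cases k (S N)) as [Hk|Hk].
{ eapply Rle_trans; [now apply HM | apply Rmax_l]. }
eapply Rle_trans; [|apply Rmax_r].
apply le_INR in Hk; rewrite S_INR in Hk.
rewrite Cmod_inv by apply b_regular.
assert (Hpos := proj1 (Cmod_gt_0 _) (b_regular k)).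
assert (Htri := Cmod_triangle (b + INR k) (- b)).
replace (b + INR k + - b) with (RtoC (INR k)) in Htri by ring.
rewrite Cmod_opp, Cmod_R, Rabs_pos_eq in Htri by apply pos_INR.
apply Rmult_le_reg_r with (Cmod (b + INR k)); [exact Hpos|].
rewrite Rmult_assoc, Rinv_l, S_INR by lra; lra.
Qed.

(** The logarithmic derivative of (a)_n with respect to a, at a = b; for b = 1 it is the harmonic
    number. *)
Definition harmonic (n : nat) : C := Csum (fun k => / (b + INR k)) n.

(** The quotient is the product of 1 + h/(b+k) over k < n, so this is its Taylor remainder of second
    order at h = 0. *)
Definition poch_remainder (h : C) (n : nat) : C :=
  Cpoch (b + h) n / Cpoch b n - 1 - h * harmonic n.

Lemma harmonic_bound (M : R) (n : nat) :
  (forall k, (Cmod (/ (b + INR k)) <= M)%R) -> (Cmod (harmonic n) <= INR n * M)%R.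
Proof.
intros HM; induction n as [|n IH]; unfold harmonic in *; cbn [Csum].
- rewrite Cmod_0; simpl; lra.
- eapply Rle_trans; [apply Cmod_triangle|]; rewrite S_INR.
  specialize (HM n); lra.
Qed.

(** Multiplying 1 + h H_n by the new factor 1 + h/(b+n) creates one term beyond the linear ones, the
    cross term of order h^2. *)
Lemma poch_remainder_S (h : C) (n : nat) :
  poch_remainder h (S n)
  = poch_remainder h n * (1 + h * / (b + INR n)) + h * h * (/ (b + INR n) * harmonic n).
Proof.
unfold poch_remainder, harmonic; cbn [Csum Cpoch].
generalize (Cpoch_neq_0 n) (b_regular n); intros; field; auto.
Qed.

(* (1+M)^n - 1 - nM is the remainder of the majorant (1+M)^n of the product
   of the 1 + h/(b+k), which makes the induction exact. *)
Lemma poch_remainder_bound (M : R) (h : C) (n : nat) :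
  (forall k, (Cmod (/ (b + INR k)) <= M)%R) -> (Cmod h <= 1)%R ->
  (Cmod (poch_remainder h n) <= Cmod h ^ 2 * ((1 + M) ^ n - 1 - INR n * M))%R.
Proof.
intros HM Hh.
assert (Hh0 := Cmod_ge_0 h).
assert (HM0 : (0 <= M)%R) by (eapply Rle_trans; [apply Cmod_ge_0 | apply (HM 0%nat)]).
induction n as [|n IH].
- unfold poch_remainder, harmonic; simpl.
  replace (1 / 1 - 1 - h * 0) with (RtoC 0) by field.
  rewrite Cmod_0; lra.
- rewrite poch_remainder_S.
  eapply Rle_trans; [apply Cmod_triangle|]; rewrite !Cmod_mult.
  assert (Hu : (Cmod (1 + h * / (b + INR n)) <= 1 + M)%R).
  { eapply Rle_trans; [apply Cmod_triangle|]; rewrite Cmod_1, Cmod_mult.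
    assert (Cmod h * Cmod (/ (b + INR n)) <= 1 * M)%R
      by (apply Rmult_le_compat; auto using Cmod_ge_0); lra. }
  assert (H1 := Rmult_le_compat _ _ _ _ (Cmod_ge_0 _) (Cmod_ge_0 _) IH Hu).
  assert (H2 := Rmult_le_compat _ _ _ _ (Cmod_ge_0 _) (Cmod_ge_0 _)
                  (HM n) (harmonic_bound M n HM)).
  assert (H3 := Rmult_le_compat_l (Cmod h * Cmod h) _ _
                  (Rmult_le_pos _ _ Hh0 Hh0) H2).
  rewrite S_INR; cbn [pow]; nra.
Qed.

(** The coefficient (a)_n/(b)_n splits into 1, the linear term h H_n and the remainder. The first
    two series cancel against the subtracted terms, and the third is of order h^2 uniformly for |h|
    <= 1. *)
Lemma hypergeometric_1F1_derivative_bound (x : R) :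
  exists K : R, forall a : C, (Cmod (a - b) <= 1)%R ->
    (Cmod (pFq [a] [b] x - pFq [b] [b] x
           - (a - b) * C_Series (fun n => harmonic n * (RtoC x ^ n / INR (fact n)))%C)
     <= K * Cmod (a - b) ^ 2)%R.
Proof.
destruct reciprocal_shift_bound as [M0 HM0].
set (M := Rmax M0 0).
assert (HMpos : (0 <= M)%R) by apply Rmax_r.
assert (HM : forall k, (Cmod (/ (b + INR k)) <= M)%R).
{ intros k; eapply Rle_trans; [|apply Rmax_l]; eapply Rle_trans; [|apply (HM0 k)].
  rewrite S_INR; generalize (Cmod_ge_0 (/ (b + INR k))) (pos_INR k); nra. }
(* Bernoulli's inequality turns the linear bound n M on [harmonic] into the geometric one that the
   convergence test asks for. *)
assert (Hbern : forall n, (1 + INR n * M <= (1 + M) ^ n)%R).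
{ induction n as [|n IH]; [simpl; lra|].
  rewrite S_INR; cbn [pow]; generalize (pos_INR n); nra. }
(* This is 2 e^((1+M)|x|): the sum of the majorants (1+M)^n |x|^n / n!, with the factor 2 of
   [Cmod_C_Series_le]. *)
exists (2 * Series (fun n => ((1 + M) * Rabs x) ^ n / INR (fact n)))%R; intros a Ha.
set (h := a - b) in *.
set (e := fun n => RtoC x ^ n / RtoC (INR (fact n))).
assert (Hrem : forall n, (Cmod (poch_remainder h n) <= Cmod h ^ 2 * (1 + M) ^ n)%R).
{ intros n; eapply Rle_trans; [apply poch_remainder_bound with (M := M); trivial|].
  apply Rmult_le_compat_l; [apply pow2_ge_0|].
  generalize (pos_INR n); nra. }
assert (Se : ex_series (fun n => Cmod (1 * e n))).
{ apply ex_series_Cmod_exp_geom with (A := 1%R) (q := 1%R); intros n.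
  rewrite pow1, Cmod_1; lra. }
assert (Sh : ex_series (fun n => Cmod (harmonic n * e n))).
{ apply ex_series_Cmod_exp_geom with (A := 1%R) (q := (1 + M)%R); intros n.
  generalize (harmonic_bound M n HM) (Hbern n); lra. }
assert (Sr : ex_series (fun n => Cmod (poch_remainder h n * e n))).
{ apply ex_series_Cmod_exp_geom with (A := (Cmod h ^ 2)%R) (q := (1 + M)%R), Hrem. }
assert (E1 : pFq [a] [b] x = C_Series (fun n => 1 * e n)
  + h * C_Series (fun n => harmonic n * e n)
  + C_Series (fun n => poch_remainder h n * e n)).
{ rewrite <- C_Series_scal, <- !C_Series_plus
    by auto using ex_series_Cmod_plus, ex_series_Cmod_scal.
  apply C_Series_ext; intros n; unfold poch_remainder.
  replace (b + h) with a by (unfold h; ring).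
  unfold Cprod; cbn [map fold_right]; fold (e n).
  generalize (Cpoch_neq_0 n); intros; field; auto. }
assert (E0 : pFq [b] [b] x = C_Series (fun n => 1 * e n)).
{ apply C_Series_ext; intros n; unfold Cprod; cbn [map fold_right]; fold (e n).
  generalize (Cpoch_neq_0 n); intros; field; auto. }
rewrite E1, E0; fold e.
match goal with |- (Cmod ?u <= _)%R =>
  replace u with (C_Series (fun n => poch_remainder h n * e n)) by (unfold e; ring) end.
rewrite (Rmult_comm _ (Cmod h ^ 2)), <- Rmult_assoc, (Rmult_comm _ 2), Rmult_assoc.
rewrite <- Series_scal_l.
apply Cmod_C_Series_le.
- intros n; unfold e; rewrite Cmod_mult, Cmod_exp_term, Rpow_mult_distr.
  replace (Cmod h ^ 2 * ((1 + M) ^ n * Rabs x ^ n / INR (fact n)))%R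
    with (Cmod h ^ 2 * (1 + M) ^ n * (Rabs x ^ n / INR (fact n)))%R
    by (unfold Rdiv; ring).
  apply Rmult_le_compat_r; [|apply Hrem].
  apply Rdiv_le_0_compat; [apply pow_le, Rabs_pos | apply INR_fact_lt_0].
- apply (ex_series_scal_l (K := R_AbsRing) (V := R_NormedModule)).
  eexists; apply is_series_exp.
Qed.

End LowerParameter.

(** * Coefficient identities behind the product with e^x *)

Lemma Cpoch_incr_1 (b : C) (n : nat) : Cpoch b (S n) = b * Cpoch (b + 1) n.
Proof.
induction n as [|n IH].
- simpl; ring.
- change (Cpoch b (S (S n))) with (Cpoch b (S n) * (b + INR (S n))).
  rewrite IH, RtoC_INR_S; cbn [Cpoch]; ring.
Qed.

Lemma regular_incr_1 (b : C) :
  (forall n : nat, b + INR n <> 0) -> forall n : nat, b + 1 + INR n <> 0.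
Proof.
intros Hb n E; apply (Hb (S n)); rewrite RtoC_INR_S, <- E; ring.
Qed.

Lemma regular_0 (b : C) : (forall n : nat, b + INR n <> 0) -> b <> 0.
Proof. intros Hb E; apply (Hb 0%nat); rewrite E; simpl; ring. Qed.

(** These are the coefficients in Kummer's transformation 1F1(b; b+1; x) = e^x 1F1(1; b+1; -x),
    divided by b. The induction varies b: since (b)_(m+1) = b (b+1)_m, all terms but the last add up
    to -1/b times the previous sum at b + 1. *)
Lemma sum_inv_fact_poch (n : nat) : forall b : C, (forall k : nat, b + INR k <> 0) ->
  Csum (fun k => / INR (fact k) * ((- (1)) ^ (n - k) / Cpoch b (S (n - k)))) (S n)
  = / (INR (fact n) * (b + INR n)).
Proof.
induction n as [|n IH]; intros b Hb.
- generalize (regular_0 b Hb); intros; simpl; rewrite Cplus_0_r.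
  field; auto.
- assert (Hb0 := regular_0 b Hb).
  assert (Hb1 := regular_incr_1 b Hb).
  change (Csum ?u (S (S n))) with (Csum u (S n) + u (S n)); cbv beta.
  rewrite Nat.sub_diag.
  rewrite (Csum_ext _ (fun k => (- / b) *
    (/ INR (fact k) * ((- (1)) ^ (n - k) / Cpoch (b + 1) (S (n - k)))))).
  2:{ intros k Hk; rewrite Nat.sub_succ_l by lia.
      rewrite (Cpoch_incr_1 b (S _)), Cpow_S.
      generalize (Cpoch_neq_0 (b + 1) Hb1 (S (n - k))) (fact_neq_0_C k).
      intros; field; auto. }
  rewrite Csum_scal, IH by exact Hb1.
  rewrite RtoC_fact_S, RtoC_INR_S; cbn [Cpoch Cpow INR].
  assert (H1 := Hb (S n)); rewrite RtoC_INR_S in H1.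
  assert (H2 := INR_S_neq_0 n); rewrite RtoC_INR_S in H2.
  assert (H3 := Hb1 n); assert (H4 := fact_neq_0_C n).
  field; repeat split; auto.
Qed.

(* For b = 1 these are the Taylor coefficients of the entire exponential
   integral Ein. *)
Definition ein_coef (b : C) (m : nat) : C :=
  match m with
  | O => 0
  | S j => (- (1)) ^ j / (INR (S j) * Cpoch b (S j))
  end.

(** With E the generating series of [ein_coef], this is (e^x E)' = e^x E + e^x E' read on
    coefficients. The part e^x E' is given by [sum_inv_fact_poch] and contributes the new summand
    1/(b+n) of [harmonic], divided by n!. *)
Lemma sum_inv_fact_ein_coef (b : C) (n : nat) : (forall k : nat, b + INR k <> 0) ->
  Csum (fun k => / INR (fact k) * ein_coef b (n - k)) (S n) = harmonic b n / INR (fact n).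
Proof.
intros Hb; induction n as [|n IH].
- unfold harmonic; simpl; field; intros E; apply RtoC_inj in E; lra.
- assert (HS := INR_S_neq_0 n).
  (* Multiply by n+1 = k + (n+1-k) and absorb each summand into one factor. *)
  assert (E : INR (S n) *
    Csum (fun k => / INR (fact k) * ein_coef b (S n - k)) (S (S n))
    = harmonic b n / INR (fact n) + / (INR (fact n) * (b + INR n))).
  { rewrite <- IH, <- sum_inv_fact_poch, <- Csum_scal by exact Hb.
    rewrite (Csum_ext _ (fun k =>
      RtoC (INR k) * (/ INR (fact k) * ein_coef b (S n - k))
      + RtoC (INR (S n - k)) * (/ INR (fact k) * ein_coef b (S n - k)))).
    2:{ intros k Hk; rewrite minus_INR, RtoC_minus by lia; ring. }
    rewrite Csum_plus; f_equal.
    - rewrite Csum_incr_1.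
      replace (RtoC (INR 0)) with (RtoC 0) by reflexivity.
      rewrite Cmult_0_l, Cplus_0_l; apply Csum_ext; intros k Hk.
      rewrite Nat.sub_succ, RtoC_fact_S, RtoC_INR_S.
      generalize (fact_neq_0_C k) (INR_S_neq_0 k); rewrite RtoC_INR_S.
      intros; field; auto.
    - change (Csum ?u (S (S n))) with (Csum u (S n) + u (S n)); cbv beta.
      rewrite Nat.sub_diag; replace (RtoC (INR 0)) with (RtoC 0) by reflexivity.
      rewrite Cmult_0_l, Cplus_0_r; apply Csum_ext; intros k Hk.
      rewrite Nat.sub_succ_l by lia; cbn [ein_coef].
      generalize (fact_neq_0_C k) (INR_S_neq_0 (n - k)) (Cpoch_neq_0 b Hb (S (n - k))).
      intros; field; auto. }
  assert (Hb' := Hb n); assert (Hf := fact_neq_0_C n).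
  replace (Csum (fun k => / INR (fact k) * ein_coef b (S n - k)) (S (S n)))
    with (/ INR (S n) * (INR (S n) *
      Csum (fun k => / INR (fact k) * ein_coef b (S n - k)) (S (S n))))
    by (field; exact HS).
  rewrite E; unfold harmonic; cbn [Csum].
  rewrite RtoC_fact_S; rewrite RtoC_INR_S in *; field; auto.
Qed.

(** * Convergence of the 2F2 series and its product with e^x *)

(** The quotient n!/(b)_n is the product of (k+1)/(b+k) over k < n, and the weighted bound applies
    to each factor. *)
Lemma inv_poch_bound (b : C) : (forall n : nat, b + INR n <> 0) ->
  exists M : R, forall n : nat,
    (Cmod (INR (fact n) / Cpoch b n) <= M ^ n)%R.
Proof.
intros Hb; destruct (reciprocal_shift_bound b Hb) as [M HM].
exists M; induction n as [|n IH].
- simpl; replace (1 / 1) with (RtoC 1) by field; rewrite Cmod_1; lra.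
- replace (INR (fact (S n)) / Cpoch b (S n))
    with (INR (fact n) / Cpoch b n * (INR (S n) * / (b + INR n))).
  2:{ rewrite RtoC_fact_S, RtoC_INR_S; cbn [Cpoch].
      generalize (Cpoch_neq_0 b Hb n) (Hb n); intros; field; auto. }
  rewrite Cmod_mult, Cmod_mult, (Cmod_R (INR _)), Rabs_pos_eq by apply pos_INR.
  cbn [pow]; rewrite (Rmult_comm M).
  apply Rmult_le_compat; auto using Cmod_ge_0.
  apply Rmult_le_pos; [apply pos_INR | apply Cmod_ge_0].
Qed.

Lemma ex_series_ein_coef (b : C) (x : R) : (forall n : nat, b + INR n <> 0) ->
  ex_series (fun n => Cmod (ein_coef b (S n) * RtoC x ^ n)).
Proof.
intros Hb; destruct (inv_poch_bound b Hb) as [M HM].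
apply ex_series_ext with (fun n => Cmod
  (INR (fact n) * ein_coef b (S n) * (RtoC x ^ n / INR (fact n)))).
{ intros n; f_equal; generalize (fact_neq_0_C n); intros; field; auto. }
apply ex_series_Cmod_exp_geom with (A := M) (q := M); intros n.
change (M * M ^ n)%R with (M ^ S n)%R.
eapply Rle_trans; [|apply (HM (S n))].
assert (Hp := Cpoch_neq_0 b Hb (S n)); assert (HS := INR_S_neq_0 n).
(* Rewriting n!/(n+1) as (n+1)!/(n+1)^2 exposes the bounded quotient at index n+1; the factor
   1/(n+1)^2 is then estimated by 1. *)
replace (INR (fact n) * ein_coef b (S n))
  with ((- (1)) ^ n * (/ (INR (S n) * INR (S n)) * (INR (fact (S n)) / Cpoch b (S n)))).
2:{ cbn [ein_coef]; rewrite RtoC_fact_S, <- RtoC_INR_S; field; auto. }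
rewrite !Cmod_mult, Cmod_pow, Cmod_m1, pow1, Rmult_1_l.
rewrite <- (Rmult_1_l (Cmod (INR (fact (S n)) / _))) at 2.
apply Rmult_le_compat_r; [apply Cmod_ge_0|].
rewrite Cmod_inv by now apply Cmult_neq_0.
rewrite Cmod_mult, Cmod_R, Rabs_pos_eq by apply pos_INR.
rewrite <- Rinv_1; apply Rinv_le_contravar; [lra|].
rewrite S_INR; generalize (pos_INR n); nra.
Qed.

Lemma Cpoch_1 (n : nat) : Cpoch 1 n = INR (fact n).
Proof.
induction n as [|n IH]; [reflexivity|].
rewrite RtoC_fact_S; cbn [Cpoch]; rewrite IH; ring.
Qed.

Lemma Cpoch_2 (n : nat) : Cpoch 2 n = INR (fact (S n)).
Proof.
rewrite <- Cpoch_1, Cpoch_incr_1.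
replace (1 + 1) with (RtoC 2) by (rewrite <- RtoC_plus; f_equal; ring); ring.
Qed.

(** Here (1)_n (1)_n / ((2)_n n!) = 1/(n+1), and (b)_(n+1) = b (b+1)_n accounts for the factor b. *)
Lemma pFq_2F2_ein_coef (b : C) (x : R) : (forall n : nat, b + INR n <> 0) ->
  pFq [RtoC 1; RtoC 1] [b + 1; RtoC 2] (- x)
  = b * C_Series (fun n => ein_coef b (S n) * RtoC x ^ n).
Proof.
intros Hb; rewrite <- C_Series_scal by now apply ex_series_ein_coef.
apply C_Series_ext; intros n; unfold Cprod; cbn [map fold_right ein_coef].
rewrite Cpoch_1, Cpoch_2, Cpoch_incr_1, RtoC_fact_S, RtoC_INR_S.
replace (- RtoC x) with (- (1) * x) by ring; rewrite Cpow_mult_l.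
generalize (fact_neq_0_C n) (INR_S_neq_0 n) (regular_0 b Hb)
  (Cpoch_neq_0 (b + 1) (regular_incr_1 b Hb) n); rewrite RtoC_INR_S.
intros; field; auto.
Qed.

Lemma C_Series_harmonic (b : C) (x : R) : (forall n : nat, b + INR n <> 0) ->
  C_Series (fun n => harmonic b n * (RtoC x ^ n / INR (fact n)))
  = exp x * (x / b * pFq [RtoC 1; RtoC 1] [b + 1; RtoC 2] (- x)).
Proof.
intros Hb; assert (Hb0 := regular_0 b Hb).
assert (Sw := ex_series_ein_coef b x Hb).
assert (Sb : ex_series (fun n => Cmod (ein_coef b n * RtoC x ^ n))).
{ apply ex_series_incr_1.
  apply ex_series_ext with (fun n => Cmod (x * (ein_coef b (S n) * RtoC x ^ n))).
  - intros n; f_equal; rewrite Cpow_S; ring.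
  - now apply ex_series_Cmod_scal. }
rewrite pFq_2F2_ein_coef by exact Hb.
rewrite <- (is_series_unique _ _ (is_series_exp x)).
(* Since [ein_coef b 0] is 0, shifting the index costs exactly one factor x, while b cancels. The
   full series is the one that enters the Cauchy product. *)
replace (x / b * (b * C_Series (fun n => ein_coef b (S n) * RtoC x ^ n)))
  with (C_Series (fun n => ein_coef b n * RtoC x ^ n)).
2:{ rewrite C_Series_incr_1 by exact Sb; cbn [ein_coef].
    rewrite (C_Series_ext (fun n => _ / _ * RtoC x ^ S n)
      (fun n => x * (ein_coef b (S n) * RtoC x ^ n)))
      by (intros n; rewrite Cpow_S; cbn [ein_coef]; ring).
    rewrite C_Series_scal by exact Sw; cbn [ein_coef]; field; exact Hb0. }
rewrite <- C_Series_Cauchy_product; [|  |exact Sb].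
2:{ apply ex_series_ext with (fun n => (Rabs x ^ n / INR (fact n))%R).
    - intros n; now rewrite <- Cmod_exp_term, Cpow_div_fact, Cmod_R.
    - eexists; apply is_series_exp. }
apply C_Series_ext; intros n.
rewrite (Csum_ext _ (fun k => RtoC x ^ n * (/ INR (fact k) * ein_coef b (n - k)))).
2:{ intros k Hk; rewrite <- Cpow_div_fact.
    replace n with (k + (n - k))%nat at 3 by lia.
    rewrite Cpow_add_r; generalize (fact_neq_0_C k); intros; field; auto. }
rewrite Csum_scal, sum_inv_fact_ein_coef by exact Hb.
generalize (fact_neq_0_C n); intros; field; auto.
Qed.

(** * Complex powers of a real base, and the Whittaker function *)

Lemma Cexp_plus (z w : C) : Cexp (z + w) = Cexp z * Cexp w.
Proof.
unfold Cexp; rewrite re_plus, im_plus, exp_plus, cos_plus, sin_plus.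
unfold RtoC, Cmult; simpl; f_equal; ring.
Qed.

Lemma Cexp_Rlog (x : R) : x <> 0%R -> Cexp (Defs.Rlog x) = x.
Proof.
intros Hx; unfold Cexp, Defs.Rlog; cbn [Re Im fst snd].
rewrite exp_ln by now apply Rabs_pos_lt.
destruct (Rlt_dec x 0) as [H|H].
- rewrite cos_PI, sin_PI, Rabs_left by exact H.
  unfold RtoC, Cmult; simpl; f_equal; ring.
- rewrite cos_0, sin_0, Rabs_pos_eq by lra.
  unfold RtoC, Cmult; simpl; f_equal; ring.
Qed.

(** The hypothesis matters at x = 0 only: there a = -1 would give the conventional 0^0 = 1 on the
    left and 0 on the right. *)
Lemma Rcpow_plus_1 (x : R) (a : C) : a + 1 <> 0 ->
  Rcpow x (a + 1) = Rcpow x a * x.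
Proof.
intros Ha; unfold Rcpow; destruct (Req_EM_T x 0) as [->|Hx].
- destruct (Ceq_dec (a + 1) 0); [contradiction | ring].
- rewrite <- (Cexp_Rlog x Hx); rewrite <- Cexp_plus; f_equal; ring.
Qed.

Theorem theorem3 :
  forall (mu : C) (x : R),
    (forall n : nat, (1 <= n)%nat -> 2 * mu <> - INR n) ->
    mu <> - (1 / 2) ->
    is_derive (K := C_AbsRing) (V := C_NormedModule)
      (fun kappa : C => whittakerM kappa mu x)
      (- mu - 1 / 2)
      (- (Rcpow x (mu + 3 / 2) / (2 * mu + 1)) * exp (x / 2)
       * pFq [RtoC 1; RtoC 1] [2 * (mu + 1); RtoC 2] (- x)).
Proof.
intros mu x Hmu _.
assert (H2 : RtoC 2 <> 0) by (intros E; apply RtoC_inj in E; lra).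
assert (Hb : forall n : nat, 1 + 2 * mu + INR n <> 0).
{ intros n E; apply (Hmu (S n)); [lia|]; rewrite RtoC_INR_S.
  replace (2 * mu) with (1 + 2 * mu + INR n - (INR n + 1)) by ring.
  rewrite E; ring. }
assert (Hb0 := regular_0 _ Hb).
set (c := Rcpow x (mu + 1 / 2) * exp (- x / 2)).
set (D := C_Series (fun n => harmonic (1 + 2 * mu) n * (RtoC x ^ n / INR (fact n)))).
destruct (hypergeometric_1F1_derivative_bound (1 + 2 * mu) Hb x) as [K HK].
(* The prefactor [c] is independent of kappa, and the upper parameter 1/2 + mu - kappa has slope -1
   in kappa, whence the sign in -(c D). *)
replace (- (Rcpow x (mu + 3 / 2) / (2 * mu + 1)) * exp (x / 2)
  * pFq [RtoC 1; RtoC 1] [2 * (mu + 1); RtoC 2] (- x)) with (- (c * D)).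
2:{ unfold c, D; rewrite C_Series_harmonic by exact Hb.
    replace (2 * (mu + 1)) with (1 + 2 * mu + 1)
      by (replace (RtoC 2) with (1 + 1) by (rewrite <- RtoC_plus; f_equal; ring); ring).
    replace (mu + 3 / 2) with (mu + 1 / 2 + 1)
      by (replace (RtoC 3) with (1 + 2) by (rewrite <- RtoC_plus; f_equal; ring);
          field; exact H2).
    rewrite Rcpow_plus_1.
    (* If mu + 3/2 vanished, so would 1 + 2 mu + 2, against regularity at index 2. *)
    2:{ intros E; apply (Hb 2%nat).
        replace (1 + 2 * mu + INR 2) with (2 * (mu + 1 / 2 + 1)).
        - rewrite E; ring.
        - simpl; rewrite RtoC_plus.
          replace (RtoC 2) with (1 + 1) by (rewrite <- RtoC_plus; f_equal; ring).
          field; rewrite <- RtoC_plus; intros E'; apply RtoC_inj in E'; lra. }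
    replace (exp (x / 2)) with (exp (- x / 2) * exp x)%R
      by (rewrite <- exp_plus; f_equal; field).
    rewrite RtoC_mult.
    replace (2 * mu + 1) with (1 + 2 * mu) by ring.
    field; exact Hb0. }
apply is_derive_quadratic with (K := (Cmod c * K)%R); intros y Hy.
set (h := y - (- mu - 1 / 2)) in *.
(* At kappa = -mu - 1/2 the upper parameter equals the lower one, and an increment h of kappa moves
   it by -h. *)
assert (Ea : 1 / 2 + mu - y - (1 + 2 * mu) = - h).
{ unfold h; field; exact H2. }
assert (Eb : 1 / 2 + mu - (- mu - 1 / 2) = 1 + 2 * mu) by (field; exact H2).
specialize (HK (1 / 2 + mu - y)); rewrite Ea, Cmod_opp in HK; specialize (HK Hy).
fold D in HK.
unfold whittakerM; rewrite Eb; fold c.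
match goal with |- (Cmod ?u <= _)%R =>
  replace u with (c * (pFq [1 / 2 + mu - y] [1 + 2 * mu] x
    - pFq [1 + 2 * mu] [1 + 2 * mu] x - - h * D)) by ring end.
rewrite Cmod_mult, Rmult_assoc.
apply Rmult_le_compat_l; [apply Cmod_ge_0 | exact HK].
Qed.
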